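(* Let $G$ be a totally disconnected, locally compact group with property (LD) and let $K$ be a closed subnormal subgroup of an open subgroup of $G$. Then some open subgroup of $K$ is a local direct factor of $G$; moreover, $K$ has property (LD).
   Context: All groups are locally compact Hausdorff topological groups. Direct products carry the product topology; direct factors are closed subgroups. A local direct factor of $G$ is a subgroup that is a direct factor of an open subgroup of $G$. Property (LD): a totally disconnected locally compact group $G$ has property (LD) if for every closed subgroup $K$ of $G$ with open normalizer, there is an open subgroup $L$ of $K$ that is a direct factor of an open subgroup of $G$. *)

(* Defs.v *)
From HB Require Import structures.
From mathcomp Require Import all_boot all_order all_algebra.
From mathcomp Require Import all_classical topology.

Set Implicit Arguments.
Unset Strict Implicit.
Unset Printing Implicit Defensive.

Local Open Scope classical_set_scope.
Local Open Scope group_scope.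

HB.mixin Record isTopologicalGroup G & Group G & Topological G := {
  mulg_continuous : continuous (fun p : G * G => p.1 * p.2) ;
  invg_continuous : continuous (fun x : G => x^-1)
}.

#[short(type="topologicalGroupType")]
HB.structure Definition TopologicalGroup :=
  {G of Group G & Topological G & isTopologicalGroup G}.

(* Subgroups are sets in an ambient topological group G, each carrying the
   topology induced from G; G itself, as a group, is [set: G]. "Open in H" and
   "closed in H" are openness and closedness in [subspace H]. *)

Section Subgroups.
Context {G : topologicalGroupType}.
Implicit Types A B H K L U : set G.

Definition subgroup A H :=
  [/\ group_closed [in A], group_closed [in H] & A `<=` H].

Definition open_subgroup A H := subgroup A H /\ open (A : set (subspace H)).

Definition closed_subgroup A H := subgroup A H /\ closed (A : set (subspace H)).

Definition normalizer H A : set G :=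
  [set g | H g /\ [set x ^ g | x in A] = A].

Definition normal_subgroup A H := subgroup A H /\ normalizer H A = H.

(* The intermediate terms of the series need not be closed. *)
Definition subnormal_subgroup A H :=
  subgroup A H /\
  exists (n : nat) (s : nat -> set G),
    [/\ s 0 = A, s n = H &
        forall i, (i < n)%N -> normal_subgroup (s i) (s i.+1)].

(* Internal direct product of topological groups: (a, b) |-> a * b is a group
   isomorphism from A x B onto U, and a homeomorphism for the product
   topology. The latter is not automatic, for want of sigma-compactness. *)
Definition direct_product A B U :=
  let mul := fun p : G * G => p.1 * p.2 in
  [/\ closed_subgroup A U, closed_subgroup B U,
      forall a b, A a -> B b -> commute a b,
      set_bij (A `*` B) U mul &
      forall W : set (G * G), W `<=` A `*` B ->
        open (W : set (subspace (A `*` B))) <->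
        open (mul @` W : set (subspace U))].

Definition direct_factor A U := exists B, direct_product A B U.

Definition local_direct_factor A H :=
  exists2 U, open_subgroup U H & direct_factor A U.

(* Stated on the type [set_type H], because the library's [locally_compact H]
   is not intrinsic when H is not closed (it holds for the rationals in the
   real line). *)
Definition tdlc H :=
  [/\ hausdorff_space (set_type H),
      locally_compact [set: set_type H] &
      totally_disconnected [set: set_type H]].

Definition property_LD H :=
  [/\ group_closed [in H], tdlc H &
      forall K, closed_subgroup K H ->
        open (normalizer H K : set (subspace H)) ->
        exists2 L, open_subgroup L K & local_direct_factor L H].

End Subgroups.

(* Main.v *)
Require Import Defs.
From mathcomp Require Import all_boot all_order all_algebra.
From mathcomp Require Import all_classical topology.

(** Everything rests on one remark ([LD_direct_factor]). Suppose that L is a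
direct factor of an open subgroup L x M of G and that J is a closed subgroup
of L normalized by an open neighbourhood N of 1 in L. Since M centralizes L,
it normalizes J, so the normalizer of J in G contains N M, which is open in G
because L x M carries the product topology. Property (LD) of G therefore
applies to J, and yields an open subgroup of J that is a local direct factor
of G.

For the first claim, go down the subnormal series from U to K, replacing its
terms by their closures; closures of consecutive terms are still normal in one
another, and the last one is K since K is closed. U is normalized by itself,
so (LD) applies to it. If C is closed and normal in D, and L is an open
subgroup of D that is a local direct factor of G, then the remark with
J = C n L and N = L gives an open subgroup of C n L, hence of C, that is a
local direct factor of G ([LD_normal_step], [LD_subnormal_closure]).

For the second claim ([LD_closed_local_factor]), let L be the subgroup of K
just found, and J a closed subgroup of K with open normalizer in K. The remark
applied to J n L, with N the trace on L of that normalizer, gives an open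
subgroup A of J with A x B open in G; intersecting with K, which contains A,
leaves A x (B n K), open in K ([direct_product_setI]). Finally K is totally
disconnected and locally compact because it is closed in G. *)

Local Open Scope classical_set_scope.
Local Open Scope group_scope.

(** * Pulling topological properties back along an embedding *)

Section Embeddings.
Set Implicit Arguments.
Unset Strict Implicit.
Context {X Y : topologicalType} {f : X -> Y}.
Hypotheses (f_inj : injective f) (f_cont : continuous f).

Lemma hausdorff_injective : hausdorff_space Y -> hausdorff_space X.
Proof.
move=> hY p q pq; apply/f_inj/hY => A B fpA fqB.
have [x [Ax Bx]] := pq _ _ (f_cont fpA) (f_cont fqB).
by exists (f x).
Qed.

Lemma totally_disconnected_injective :
  totally_disconnected [set: Y] -> totally_disconnected [set: X].
Proof.
move=> tdY x _; apply/seteqP; split=> [y [C [Cx _ Cc Cy]]|_ ->]; last first.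
  exact: connected_component_refl.
apply: f_inj; suff : connected_component [set: Y] (f x) (f y) by rewrite tdY.
exists (f @` C); last by exists y.
split=> //.
by apply: connected_continuous_connected => //; exact: continuous_subspaceT.
Qed.

(** The condition on neighbourhoods says that f induces the topology of X. The
preimage of a compact neighbourhood P is compact: a filter on it has an image
with a cluster point in P, which lies in the closed range of f, and the
induced topology brings it back to X. *)
Lemma locally_compact_closed_embedding :
    (forall x B, nbhs x B -> exists2 O, nbhs (f x) O & f @^-1` O `<=` B) ->
    closed (range f) ->
  locally_compact [set: Y] -> locally_compact [set: X].
Proof.
move=> f_emb f_closed lcY x _.
have [P fxP [cP clP]] := lcY (f x) Logic.I.
rewrite withinET in fxP.
exists (f @^-1` P); first by rewrite withinET; exact: f_cont.
split; last exact: preimage_closed.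
move=> F FF FP.
have [y [Py Fy]] := cP (f @ F) _ FP.
have /f_closed [z _ zy] : closure (range f) y.
  have Ff : F (f @^-1` range f) by apply: filterE => t; exists t.
  by move=> B By; apply: Fy Ff By.
rewrite -zy in Py Fy.
exists z; split=> // A B FA /f_emb [O zO OB].
have FfA : F (f @^-1` (f @` A)) by apply: filterS FA => a Aa; exists a.
have [_ [[a Aa <-] Oa]] := Fy _ _ FfA zO.
by exists a; split=> //; apply: OB.
Qed.

End Embeddings.

(** * Subgroups and normalizers *)

Section Groups.
Set Implicit Arguments.
Unset Strict Implicit.
Context {G : topologicalGroupType}.
Implicit Types A B C H K L M U V : set G.

Lemma group_closed_setP A :
  group_closed [in A] <-> A 1 /\ forall x y, A x -> A y -> A (x / y).
Proof.
split=> -[]; rewrite ?inE => A1 AD; split; rewrite ?inE // => x y.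
  by move=> Ax Ay; have := AD x y; rewrite !inE; apply.
by rewrite !inE; apply: AD.
Qed.

Lemma group_set1 A : group_closed [in A] -> A 1.
Proof. by case/group_closed_setP. Qed.

Lemma group_setV A x : group_closed [in A] -> A x -> A x^-1.
Proof. by case/group_closed_setP=> A1 AD Ax; rewrite -div1g; apply: AD. Qed.

Lemma group_setM A x y : group_closed [in A] -> A x -> A y -> A (x * y).
Proof.
move=> Ag Ax Ay; have [_ AD] := (group_closed_setP A).1 Ag.
by rewrite -[y]invgK; apply: AD => //; apply: group_setV.
Qed.

Lemma group_closed_setI A B :
  group_closed [in A] -> group_closed [in B] -> group_closed [in A `&` B].
Proof.
move=> /group_closed_setP[A1 AD] /group_closed_setP[B1 BD].
by apply/group_closed_setP; split=> // x y [? ?] [? ?]; split; auto.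
Qed.

Lemma group_closed_setT : group_closed [in [set: G]].
Proof. by apply/group_closed_setP. Qed.

(** The equality of sets that defines the normalizer, in a form where g and its
inverse are on the same footing. *)
Lemma normalizerP H A g :
  normalizer H A g <-> H g /\ forall x, A (x ^ g) <-> A x.
Proof.
split=> -[Hg Ag]; split=> //.
  move=> x; split=> [|Ax]; rewrite -{1}Ag => //; last by exists x.
  by case=> y Ay /conjg_inj <-.
apply/seteqP; split=> [_ [x Ax <-]|x Ax]; first exact/Ag.
by exists (x ^ g^-1); rewrite ?conjgKV //; apply/Ag; rewrite conjgKV.
Qed.

Lemma group_closed_normalizer A : group_closed [in normalizer [set: G] A].
Proof.
apply/group_closed_setP; split=> [|x y /normalizerP[_ xA] /normalizerP[_ yA]].
  by apply/normalizerP; split=> // x; rewrite conjg1.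
by apply/normalizerP; split=> // z; rewrite -yA -conjgM mulgVK xA.
Qed.

(** Containment suffices, because it also holds for the inverses of the elements
of H. *)
Lemma normalizer_conj_closed A H :
    group_closed [in H] -> (forall x g, A x -> H g -> A (x ^ g)) ->
  H `<=` normalizer H A.
Proof.
move=> Hg AHA g Hg'; apply/normalizerP; split=> // x; split=> Ax.
  by rewrite -(conjgK g x); apply: AHA => //; apply: group_setV.
exact: AHA.
Qed.

Lemma group_normalizes_itself A :
  group_closed [in A] -> A `<=` normalizer A A.
Proof.
move=> Ag; apply: normalizer_conj_closed => // x g Ax Ag'; rewrite conjgE.
by do 2?[apply: group_setM => //]; apply: group_setV.
Qed.

Lemma normalizer_setI A H L :
  group_closed [in L] -> normalizer H A `&` L `<=` normalizer L (A `&` L).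
Proof.
move=> Lg g [/normalizerP[_ gA] Lg'].
have /normalizerP[_ gL] := group_normalizes_itself Lg Lg'.
by apply/normalizerP; split=> // x; split=> -[/gA ? /gL ?].
Qed.

(** * Continuity, closures and open subgroups *)

Lemma continuousMg (T : topologicalType) (f g : T -> G) :
  continuous f -> continuous g -> continuous (fun x => f x * g x).
Proof.
move=> fc gc x; apply: continuous2_cvg; [|exact: fc|exact: gc].
exact: (mulg_continuous (f x, g x)).
Qed.

Lemma continuousVg (T : topologicalType) (f : T -> G) :
  continuous f -> continuous (fun x => (f x)^-1).
Proof.
by move=> fc x; apply: continuous_comp; [exact: fc|exact: invg_continuous].
Qed.

(** The common reason why closures of subgroups are subgroups and why the
closure of B normalizes the closure of A when B normalizes A: the closure of a product
set contains the product of the closures. *)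
Lemma closure_continuous2 (f : G * G -> G) A B C :
    continuous f -> (forall a b, A a -> B b -> C (f (a, b))) ->
  forall a b, closure A a -> closure B b -> closure C (f (a, b)).
Proof.
move=> fc ABC a b Aa Bb W /fc [[P Q] /= [aP bQ] PQW].
have [x [Ax Px]] := Aa _ aP; have [y [By Qy]] := Bb _ bQ.
by exists (f (x, y)); split; [exact: ABC|exact: (PQW (x, y))].
Qed.

Lemma closure_group_closed A :
  group_closed [in A] -> group_closed [in closure A].
Proof.
move=> /group_closed_setP[A1 AD]; apply/group_closed_setP.
split; first exact: subset_closure.
apply: (closure_continuous2 (f := fun p => p.1 / p.2)) => //.
apply: continuousMg; first by move=> ?; exact: cvg_fst.
by apply: continuousVg => ?; exact: cvg_snd.
Qed.

Lemma closure_conjg A B : (forall a b, A a -> B b -> A (a ^ b)) ->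
  forall a b, closure A a -> closure B b -> closure A (a ^ b).
Proof.
apply: (closure_continuous2 (f := fun p => p.1 ^ p.2)).
apply: continuousMg; first by apply: continuousVg => ?; exact: cvg_snd.
by apply: continuousMg => ?; [exact: cvg_fst|exact: cvg_snd].
Qed.

Lemma nbhs_lcoset A x : nbhs 1 A -> nbhs x [set y | A (x^-1 * y)].
Proof.
have xc : continuous (fun y => x^-1 * y).
  by apply: continuousMg => y //; exact: cvg_cst.
by rewrite -(mulVg x) => /xc.
Qed.

(** Translates of a neighbourhood of 1 in A by elements of A stay in A. *)
Lemma open_group A : group_closed [in A] -> nbhs 1 A -> open A.
Proof.
move=> Ag A1; rewrite openE => x Ax; apply: (filterS _ (nbhs_lcoset x A1)) => y.
by move=> /(group_setM Ag Ax); rewrite mulVKg.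
Qed.

(** A coset of A that meets A is A, so no point outside A adheres to A. *)
Lemma open_group_closed A : group_closed [in A] -> open A -> closed A.
Proof.
move=> Ag oA x Ax.
have /Ax [y [Ay xy]] : nbhs x [set y | A (x^-1 * y)].
  by apply: nbhs_lcoset; apply: open_nbhs_nbhs; split=> //; apply: group_set1.
have -> : x = y / (x^-1 * y) by rewrite invgM invgK mulVKg.
by apply: group_setM => //; apply: group_setV.
Qed.

(** * Open and closed subgroups of subgroups *)

Lemma open_subgroupT A : open_subgroup A [set: G] -> open A /\ closed A.
Proof.
case=> -[Ag _ _] /open_subspaceP[O oO]; rewrite !setIT => OA; rewrite OA in oO.
by split=> //; apply: open_group_closed.
Qed.

Lemma closed_subgroup_closed A H : closed_subgroup A H -> closed H -> closed A.
Proof.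
by case=> -[_ _ AH] cA cH; rewrite -(setIidl AH) closed_setIS.
Qed.

Lemma open_subgroup_trans A B C :
  open_subgroup A B -> open_subgroup B C -> open_subgroup A C.
Proof.
move=> [[Ag _ AB] /open_subspaceP[O oO OA]].
move=> [[_ Cg BC] /open_subspaceP[P oP PB]].
split; first by split=> //; apply: subset_trans BC.
apply/open_subspaceP; exists (O `&` P); first exact: openI.
by rewrite -setIA PB (setIidl BC) OA !setIidl //; apply: subset_trans BC.
Qed.

Lemma open_subgroupI A H K :
  subgroup K H -> open_subgroup A H -> open_subgroup (A `&` K) K.
Proof.
move=> [Kg _ KH] [[Ag _ AH] /open_subspaceP[O oO OA]].
split; first by split=> //; exact: group_closed_setI.
apply/open_subspaceP; exists O => //.
by rewrite -setIA setIid -(setIidr KH) !setIA OA -setIA.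
Qed.

Lemma closed_subgroupI A H K :
  subgroup K H -> closed_subgroup A H -> closed_subgroup (A `&` K) K.
Proof.
move=> [Kg _ KH] [[Ag _ AH] /closed_subspaceP[O oO OA]].
split; first by split=> //; exact: group_closed_setI.
apply/closed_subspaceP; exists O => //.
by rewrite -setIA setIid -(setIidr KH) !setIA OA -setIA.
Qed.

(** * Direct products *)

(** If K contains A, then the B-component of an element of K is in K, so that
the decomposition of U restricts to one of its intersection with K. The
multiplication restricts to a homeomorphism: it is open since it is open on
A x B, and its inverse images of open sets are open by plain continuity. *)
Lemma direct_product_setI A B U K :
    group_closed [in K] -> A `<=` K -> direct_product A B U ->
  direct_product A (B `&` K) (U `&` K).
Proof.
move=> Kg AK [cA cB AB [UAB injAB surjAB] homAB].
have [[Ag Ug AU] _] := cA; have [[Bg _ BU] _] := cB.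
have UK : subgroup (U `&` K) U.
  by split=> //; exact: group_closed_setI.
have UKm a b : A a -> (B `&` K) b -> (U `&` K) (a * b).
  by move=> Aa [Bb Kb]; split; apply: group_setM; auto.
have K_cofactor a b : A a -> K (a * b) -> K b.
  move=> Aa Kab; rewrite -(mulKg a b); apply: group_setM => //.
  by apply: group_setV => //; apply: AK.
split.
- by have := closed_subgroupI UK cA; rewrite setIA (setIidl AU) (setIidl AK).
- by have := closed_subgroupI UK cB; rewrite setIA (setIidl BU).
- by move=> a b Aa [Bb _]; apply: AB.
- split=> [[a b] [/= Aa Bb]|p q /set_mem[Ap [Bp _]] /set_mem[Aq [Bq _]]|x].
  + exact: UKm.
  + by apply: injAB; rewrite inE.
  + case=> /surjAB[[a b] [/= Aa Bb] <-] Kab; exists (a, b) => //=.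
    by do 2![split=> //=]; apply: K_cofactor Kab.
- move=> W WAB; set m := fun p : G * G => p.1 * p.2.
  have WAB' : W `<=` A `*` B by move=> p /WAB[? [? _]].
  split=> /open_subspaceP[O oO OW]; apply/open_subspaceP.
    (* W is the trace on A x (B n K) of O; compare the image of W with that of
       the trace of O on the whole of A x B. *)
    have [mO _] := homAB (O `&` (A `*` B)) (@subIsetr _ _ _).
    have /mO/open_subspaceP[P oP PO] :
        open (O `&` (A `*` B) : set (subspace (A `*` B))).
      by rewrite open_subspaceIT; exact: open_subspaceW.
    exists P => //.
    apply/seteqP; split=> [x [Px [Ux Kx]]|_ [[p Wp <-] UKp]].
      have : (P `&` U) x by [].
      rewrite PO => -[[[a b] [Oab [/= Aa Bb]] abx] _].
      split; last by [].
      exists (a, b) => //.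
      have : (O `&` (A `*` (B `&` K))) (a, b).
        do 3![split=> //=].
        by apply: (K_cofactor a) => //; rewrite [a * b]abx.
      by rewrite OW => -[].
    split=> //.
    have : ((m @` (O `&` (A `*` B))) `&` U) (m p).
      split; last by case: UKp.
      exists p => //; split; last exact: WAB'.
      have : (W `&` (A `*` (B `&` K))) p by split; [|exact: WAB].
      by rewrite -OW => -[].
    by rewrite -PO => -[].
  exists (m @^-1` O).
    by apply: open_comp => // p _; exact: mulg_continuous.
  apply/seteqP; split=> p [].
    case: p => a b /= Oab [Aa BKb]; split=> //.
    have : (O `&` (U `&` K)) (m (a, b)) by split=> //; apply: UKm.
    rewrite OW => -[[q Wq qab] _]; rewrite -(injAB q (a, b)) ?inE //.
      exact: WAB'.
    by split=> //; case: BKb.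
  move=> Wp ABp; split=> //.
  have : (m @` W `&` (U `&` K)) (m p).
    by split; [exists p|apply: UKm; case: ABp].
  by rewrite -OW => -[].
Qed.

(** This is where the product topology on A x B matters: without it, V B need
not be open. *)
Lemma open_mul_factor A B U V : direct_product A B U -> open U ->
  V `<=` A -> open (V : set (subspace A)) ->
  open [set p.1 * p.2 | p in V `*` B].
Proof.
move=> [_ _ _ [UAB _ _] homAB] oU VA /open_subspaceP[O oO OV].
have VBAB : V `*` B `<=` A `*` B by move=> p [/VA].
rewrite -(setIidl (A := _ @` _) (B := U)); last first.
  by move=> _ [p /VBAB /UAB + <-].
rewrite open_setIS //; apply/(homAB _ VBAB)/open_subspaceP.
exists (fst @^-1` O); first by apply: open_comp => // p _; exact: cvg_fst.
apply/seteqP; split=> -[a b] /= [] + [Aa Bb].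
  move=> Oa; split=> //; split=> //=.
  by have : (O `&` A) a by []; rewrite OV => -[].
case=> Va _; split=> //.
by have : (V `&` A) a by []; rewrite -OV => -[].
Qed.

Lemma local_direct_factor_sub A H K :
    A `<=` K -> subgroup K H ->
  local_direct_factor A H -> local_direct_factor A K.
Proof.
move=> AK KH [U UH [B AB]]; exists (U `&` K); first exact: open_subgroupI UH.
by exists (B `&` K); apply: direct_product_setI => //; case: KH.
Qed.

(** * Property (LD) along a subnormal series *)

(** The normalizer of J in G contains the open neighbourhood N M of 1, as N
normalizes J and M centralizes it. Taking for N any set of normalizing elements,
rather than the normalizer itself, spares proving the latter open. *)
Lemma LD_direct_factor L M U J N :
    property_LD [set: G] -> open_subgroup U [set: G] -> direct_product L M U ->
    closed_subgroup J L ->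
    N 1 -> N `<=` normalizer L J -> open (N : set (subspace L)) ->
  exists2 A, open_subgroup A J & local_direct_factor A [set: G].
Proof.
move=> [_ _ LD] U_open LM JL N1 NJ oN.
have [oU cU] := open_subgroupT U_open.
have [cLU cMU comLM _ _] := LM.
have [[Jg _ JsL] _] := JL.
have cJ : closed J.
  exact: closed_subgroup_closed JL (closed_subgroup_closed cLU cU).
apply: LD.
  by split; [split=> //; exact: group_closed_setT|exact: closed_subspaceW].
have NGg := group_closed_normalizer J.
apply/open_subspaceW/open_group => //.
have NL : N `<=` L by move=> g /NJ[].
have oNM := open_mul_factor LM oU NL oN.
have [[Mg _ _] _] := cMU.
have NM1 : [set p.1 * p.2 | p in N `*` M] 1.
  exists (1, 1) => /=; last exact: mulg1.
  by split=> //; exact: group_set1.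
apply: filterS (open_nbhs_nbhs (conj oNM NM1)) => _ [[a b] [/= Na Mb] <-].
apply: group_setM => //; first by have [_ aJ] := NJ _ Na; split.
split=> //; apply: eq_image_id => x Jx.
by rewrite conjgE (comLM x b (JsL _ Jx) Mb) mulKg.
Qed.

(** Passing from D to a closed normal subgroup C: an open subgroup L of D
normalizes the intersection of C and L. *)
Lemma LD_normal_step C D :
    property_LD [set: G] -> subgroup C D -> closed C -> D `<=` normalizer D C ->
    (exists2 L, open_subgroup L D & local_direct_factor L [set: G]) ->
  exists2 L, open_subgroup L C & local_direct_factor L [set: G].
Proof.
move=> LD CD cC DC [L LD_open [U U_open [M LM]]].
have [Cg _ _] := CD.
have [[Lg _ LsD] _] := LD_open.
have CLL : closed_subgroup (C `&` L) L.
  split; first by split=> //; exact: group_closed_setI.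
  by apply: closedI; [exact: closed_subspaceW|exact: closed_subspaceT].
have [| | |A AJ A_factor] := LD_direct_factor (N := L) LD U_open LM CLL.
- exact: group_set1.
- move=> g Lg'; apply: (normalizer_setI (H := D)) => //.
  by split=> //; apply/DC/LsD.
- exact: open_subspaceT.
exists A => //; apply: open_subgroup_trans AJ _.
by rewrite setIC; apply: open_subgroupI LD_open.
Qed.

(** The terms of the series need not be closed, and (LD) only speaks of closed
subgroups: the descent is made on the closures of the terms. *)
Lemma LD_subnormal_closure n (s : nat -> set G) :
    property_LD [set: G] -> open_subgroup (s n) [set: G] ->
    (forall i, (i < n)%N -> normal_subgroup (s i) (s i.+1)) ->
  exists2 L, open_subgroup L (closure (s 0)) & local_direct_factor L [set: G].
Proof.
move=> LD; elim: n s => [|n IHn] s s_open s_normal.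
  (* The open subgroup at the top of the series normalizes itself, so its
     normalizer in G is open. *)
  have [oU cU] := open_subgroupT s_open; rewrite -(closure_id _).1 //.
  have [[Ug _ _] _] := s_open; have [_ _] := LD; apply.
    by split; [split=> //; exact: group_closed_setT|exact: closed_subspaceW].
  apply/open_subspaceW/open_group; first exact: group_closed_normalizer.
  apply: filterS (open_nbhs_nbhs (conj oU (group_set1 Ug))) => g.
  by move=> /(group_normalizes_itself Ug)[_ gU]; split.
have [[s0g s1g s01] s1N] := s_normal 0%N isT.
apply: (@LD_normal_step _ (closure (s 1%N))) => //.
- split; [exact: closure_group_closed|exact: closure_group_closed|].
  exact: closureS.
- exact: closed_closure.
- apply: normalizer_conj_closed; first exact: closure_group_closed.
  apply: closure_conjg => a b s0a; rewrite -s1N => /normalizerP[_ ab].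
  exact/ab.
- apply: (IHn (fun i => s i.+1)) => // i lt_in.
  by apply: s_normal; rewrite ltnS.
Qed.

(** * Property (LD) for closed subgroups *)

(** The inclusion of K in H is a closed embedding. *)
Lemma tdlc_closed_subgroup K H : closed_subgroup K H -> tdlc H -> tdlc K.
Proof.
move=> [[_ _ KH] /closed_subspaceP[V cV VK]] [hH lcH tdH].
pose f (x : set_type K) : set_type H := SigSub (mem_set (KH _ (set_valP x))).
have f_inj : injective f by move=> x y /(congr1 val) /= /val_inj.
have f_cont : continuous f.
  by apply/continuousP => _ [O oO <-]; exists O.
split.
- exact: hausdorff_injective f_inj f_cont hH.
- apply: (locally_compact_closed_embedding f_cont) lcH.
  + move=> x B; rewrite nbhsE => -[_ [[O oO <-] Ox] OB].
    exists (set_val @^-1` O) => //; apply: open_nbhs_nbhs; split=> //.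
    by exists O.
  + rewrite (_ : range f = set_val @^-1` V).
      by apply: preimage_closed => // x _; exact: initial_continuous.
    apply/seteqP; split=> [_ [x _ <-]|y Vy] /=.
      have : (K `&` H) (val x) by split; [|apply: (KH)]; exact: set_valP.
      by rewrite -VK => -[].
    have Ky : K (val y).
      have : (V `&` H) (val y) by split; [|exact: set_valP].
      by rewrite VK => -[].
    by exists (SigSub (mem_set Ky)) => //; apply: val_inj.
- exact: totally_disconnected_injective f_inj f_cont tdH.
Qed.

(** A closed subgroup J of K is cut down to L, where (LD) of G is available
through the direct factor L; the complement found in G is then cut down to K. *)
Lemma LD_closed_local_factor K :
    property_LD [set: G] -> closed_subgroup K [set: G] ->
    (exists2 L, open_subgroup L K & local_direct_factor L [set: G]) ->
  property_LD K.
Proof.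
move=> LD K_closed [L LK [U U_open [M LM]]].
have [KT _] := K_closed; have [Kg _ _] := KT.
have [[Lg _ LsK] _] := LK.
split=> //; first by apply: tdlc_closed_subgroup K_closed _; case: LD.
move=> J JK oN; have [[Jg _ JsK] _] := JK.
have LKsub : subgroup L K by [].
have JL : closed_subgroup (J `&` L) L := closed_subgroupI LKsub JK.
have [| | |A AJ A_factor] := LD_direct_factor (N := normalizer K J `&` L)
  LD U_open LM JL.
- split; last exact: group_set1.
  have [_ J1] := group_set1 (group_closed_normalizer J).
  by split; first exact: group_set1.
- exact: normalizer_setI.
- have [O oO ON] := (open_subspaceP _ _).1 oN; apply/open_subspaceP.
  by exists O => //; rewrite -setIA setIid -(setIidr LsK) !setIA ON.
have AJ' : open_subgroup A J.
  apply: open_subgroup_trans AJ _; rewrite setIC.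
  exact: open_subgroupI (JK.1) LK.
exists A => //; apply: local_direct_factor_sub A_factor => //.
by have [[_ _ AsJ] _] := AJ'; apply: subset_trans JsK.
Qed.

End Groups.

Theorem lemma3p1 (G : topologicalGroupType) (U K : set G)
    (G_LD : property_LD [set: G])
    (U_open : open_subgroup U [set: G])
    (K_closed : closed_subgroup K U)
    (K_subnormal : subnormal_subgroup K U) :
  (exists2 L : set G, open_subgroup L K & local_direct_factor L [set: G]) /\
  property_LD K.
Proof.
have [_ cU] := open_subgroupT U_open.
have cK := closed_subgroup_closed K_closed cU.
have KL : exists2 L, open_subgroup L K & local_direct_factor L [set: G].
  have [_ [n [s [s0 sn s_normal]]]] := K_subnormal.
  rewrite (closure_id K).1 // -s0; apply: LD_subnormal_closure s_normal => //.
  by rewrite sn.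
split=> //; apply: LD_closed_local_factor => //.
have [[Kg _ _] _] := K_closed.
by split; [split=> //; exact: group_closed_setT|exact: closed_subspaceW].
Qed.
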